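(* Let $0\le n\le N-1$ and let $\mathbf E^n,\mathbf H^n$ be the solution of the ADI-FDTD scheme with the discrete PEC boundary condition (both defined in the context). Then for each $w\in\{x,y,z\}$, with $L(x)=I$, $L(y)=J$, $L(z)=K$, $$\begin{aligned} &\|\delta_w\mathbf E^{n+1}\|_E^2+\|\delta_w\mathbf H^{n+1}\|_H^2+\frac{(\Delta t)^2}{4\mu\varepsilon}\Big(\|\delta_w\delta_1^h\mathbf E^{n+1}\|_H^2+\|\delta_w\delta_2^h\mathbf H^{n+1}\|_E^2\Big)\\ &\quad+\|\mathbf E^{n+1}\|_{L(w)}^2+\|\mathbf H^{n+1}\|_{L(w)}^2+\frac{(\Delta t)^2}{4\mu\varepsilon}\Big(\|\delta_2^h\mathbf H^{n+1}\|_{L(w)}^2+\|\delta_1^h\mathbf E^{n+1}\|_{L(w)}^2\Big)\\ &=\|\delta_w\mathbf E^{n}\|_E^2+\|\delta_w\mathbf H^{n}\|_H^2+\frac{(\Delta t)^2}{4\mu\varepsilon}\Big(\|\delta_w\delta_1^h\mathbf E^{n}\|_H^2+\|\delta_w\delta_2^h\mathbf H^{n}\|_E^2\Big)\\ &\quad+\|\mathbf E^{n}\|_{L(w)}^2+\|\mathbf H^{n}\|_{L(w)}^2+\frac{(\Delta t)^2}{4\mu\varepsilon}\Big(\|\delta_2^h\mathbf H^{n}\|_{L(w)}^2+\|\delta_1^h\mathbf E^{n}\|_{L(w)}^2\Big). \end{aligned}$$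
   Context: **Grid.** $\varepsilon,\mu>0$ are constants; $I,J,K\ge2$ and $N\ge1$ are integers; $\Delta x=1/I$, $\Delta y=1/J$, $\Delta z=1/K$, $T>0$, $\Delta t=T/N$; $\Delta v=\Delta x\Delta y\Delta z$; $\bar l:=l+\tfrac12$ for $l=i,j,k,n$. A grid function carries spatial indices $(\alpha,\beta,\gamma)$ (integers or half-integers), referring to the point $(\alpha\Delta x,\beta\Delta y,\gamma\Delta z)$ of the unit cube, and a time index $m$ for time $m\Delta t$. ''$F|_{\alpha,\beta,\gamma}$'' means that all terms of $F$ are evaluated at spatial index $(\alpha,\beta,\gamma)$. The components live on staggered grids: $E_x$ at $(\bar i,j,k)$, $E_y$ at $(i,\bar j,k)$, $E_z$ at $(i,j,\bar k)$ (E-points); $H_x$ at $(i,\bar j,\bar k)$, $H_y$ at $(\bar i,j,\bar k)$, $H_z$ at $(\bar i,\bar j,k)$ (H-points). Here an integer $x$-index runs over $0,\dots,I$ and a half-integer one over $\tfrac12,\dots,I-\tfrac12$, similarly for $y$ (with $J$) and $z$ (with $K$). **Difference operators.** $\delta_xU_{\alpha,\beta,\gamma}=(U_{\alpha+\frac12,\beta,\gamma}-U_{\alpha-\frac12,\beta,\gamma})/\Delta x$, and $\delta_y,\delta_z$ analogously. For vector grid functions $\delta_w\mathbf U=(\delta_wU_x,\delta_wU_y,\delta_wU_z)$, $\delta_1^h\mathbf U=(\delta_yU_z,\delta_zU_x,\delta_xU_y)$, $\delta_2^h\mathbf U=(\delta_zU_y,\delta_xU_z,\delta_yU_x)$. Thus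 the components of $\delta_1^h\mathbf E$ live at H-points and those of $\delta_2^h\mathbf H$ at (interior) E-points. **ADI-FDTD scheme.** Given $\mathbf E^n,\mathbf H^n$, the fields $\mathbf E^{\bar n},\mathbf H^{\bar n}$ and $\mathbf E^{n+1},\mathbf H^{n+1}$ satisfy: Stage 1: $\frac{E_x^{\bar n}-E_x^n}{\Delta t}=\frac1{2\varepsilon}(\delta_yH_z^{\bar n}-\delta_zH_y^n)|_{\bar i,j,k}$, $\frac{E_y^{\bar n}-E_y^n}{\Delta t}=\frac1{2\varepsilon}(\delta_zH_x^{\bar n}-\delta_xH_z^n)|_{i,\bar j,k}$, $\frac{E_z^{\bar n}-E_z^n}{\Delta t}=\frac1{2\varepsilon}(\delta_xH_y^{\bar n}-\delta_yH_x^n)|_{i,j,\bar k}$, $\frac{H_x^{\bar n}-H_x^n}{\Delta t}=\frac1{2\mu}(\delta_zE_y^{\bar n}-\delta_yE_z^n)|_{i,\bar j,\bar k}$, $\frac{H_y^{\bar n}-H_y^n}{\Delta t}=\frac1{2\mu}(\delta_xE_z^{\bar n}-\delta_zE_x^n)|_{\bar i,j,\bar k}$, $\frac{H_z^{\bar n}-H_z^n}{\Delta t}=\frac1{2\mu}(\delta_yE_x^{\bar n}-\delta_xE_y^n)|_{\bar i,\bar j,k}$. Stage 2: $\frac{E_x^{n+1}-E_x^{\bar n}}{\Delta t}=\frac1{2\varepsilon}(\delta_yH_z^{\bar n}-\delta_zH_y^{n+1})|_{\bar i,j,k}$, $\frac{E_y^{n+1}-E_y^{\bar n}}{\Delta t}=\frac1{2\varepsilon}(\delta_zH_x^{\bar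 n}-\delta_xH_z^{n+1})|_{i,\bar j,k}$, $\frac{E_z^{n+1}-E_z^{\bar n}}{\Delta t}=\frac1{2\varepsilon}(\delta_xH_y^{\bar n}-\delta_yH_x^{n+1})|_{i,j,\bar k}$, $\frac{H_x^{n+1}-H_x^{\bar n}}{\Delta t}=\frac1{2\mu}(\delta_zE_y^{\bar n}-\delta_yE_z^{n+1})|_{i,\bar j,\bar k}$, $\frac{H_y^{n+1}-H_y^{\bar n}}{\Delta t}=\frac1{2\mu}(\delta_xE_z^{\bar n}-\delta_zE_x^{n+1})|_{\bar i,j,\bar k}$, $\frac{H_z^{n+1}-H_z^{\bar n}}{\Delta t}=\frac1{2\mu}(\delta_yE_x^{\bar n}-\delta_xE_y^{n+1})|_{\bar i,\bar j,k}$. The $\mathbf E$-equations hold at the E-points not lying on a face where that component is tangential (i.e. its integer indices are strictly between the endpoints); the $\mathbf H$-equations hold at all H-points. *Discrete PEC boundary condition*, for all integer and half-integer time levels $m$: $E_x^m=0$ if its $y$-index is $0$ or $J$ or its $z$-index is $0$ or $K$; $E_y^m=0$ if its $x$-index is $0$ or $I$ or its $z$-index is $0$ or $K$; $E_z^m=0$ if its $x$-index is $0$ or $I$ or its $y$-index is $0$ or $J$. **Norms.** The weight $P(\cdot)$ equals $\varepsilon$ for grid functions obtained from the electric field (e.g. $\mathbf E$, $\delta_1^h\mathbf E$, $\delta_w\delta_1^h\mathbf E$) and $\mu$ for those obtained from the magnetic field (e.g. $\mathbf H$, $\delta_2^h\mathbf H$). For $\mathbf U$ on E-points and $\mathbf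 V$ on H-points, $$\|\mathbf U\|_E^2=\Delta v\,P(\mathbf U)\Big[\sum_{i=0}^{I-1}\sum_{j=1}^{J-1}\sum_{k=1}^{K-1}U_x^2|_{\bar i,j,k}+\sum_{i=1}^{I-1}\sum_{j=0}^{J-1}\sum_{k=1}^{K-1}U_y^2|_{i,\bar j,k}+\sum_{i=1}^{I-1}\sum_{j=1}^{J-1}\sum_{k=0}^{K-1}U_z^2|_{i,j,\bar k}\Big],$$ $$\|\mathbf V\|_H^2=\Delta v\,P(\mathbf V)\Big[\sum_{i=0}^{I}\sum_{j=0}^{J-1}\sum_{k=0}^{K-1}V_x^2|_{i,\bar j,\bar k}+\sum_{i=0}^{I-1}\sum_{j=0}^{J}\sum_{k=0}^{K-1}V_y^2|_{\bar i,j,\bar k}+\sum_{i=0}^{I-1}\sum_{j=0}^{J-1}\sum_{k=0}^{K}V_z^2|_{\bar i,\bar j,k}\Big].$$ $\|\delta_w\mathbf U\|_E$ and $\|\delta_w\mathbf V\|_H$ are given by the same formulas with each component replaced by its $\delta_w$-difference, the ranges in the two directions other than $w$ being unchanged, while in direction $w$ (with $L=I,J,K$ for $w=x,y,z$): if the undifferenced component has integer $w$-index, its difference is summed over $w$-indices $\ell+\frac12$, $1\le\ell\le L-2$; if it has half-integer $w$-index, its difference is summed over integer $w$-indices $1\le\ell\le L-1$. Near-boundary norms: for $\mathbf U$ on E-points and $\mathbf V$ on H-points, $$\|\mathbf U\|_I^2=\frac{\Delta y\Delta z}{\Delta x}P(\mathbf U)\sum_{i'=1,\,I-1}\Big[\sum_{j=0}^{J-1}\sum_{k=1}^{K-1}U_y^2|_{i',\bar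 j,k}+\sum_{j=1}^{J-1}\sum_{k=0}^{K-1}U_z^2|_{i',j,\bar k}\Big],$$ $$\|\mathbf V\|_I^2=\frac{\Delta y\Delta z}{\Delta x}P(\mathbf V)\sum_{j=0}^{J-1}\sum_{k=0}^{K-1}\Big[V_x^2|_{1,\bar j,\bar k}+V_x^2|_{I-1,\bar j,\bar k}\Big]$$ ($\sum_{i'=1,I-1}$ is a sum of two terms, even if $I=2$). $\|\cdot\|_J$ and $\|\cdot\|_K$ are the analogues in the $y$- and $z$-directions: $\|\mathbf U\|_J$ uses $U_x,U_z$ at $y$-index $1,J-1$, $\|\mathbf V\|_J$ uses $V_y$ at $y$-index $1,J-1$ (factor $\Delta x\Delta z/\Delta y$); $\|\mathbf U\|_K$ uses $U_x,U_y$ at $z$-index $1,K-1$, $\|\mathbf V\|_K$ uses $V_z$ at $z$-index $1,K-1$ (factor $\Delta x\Delta y/\Delta z$), the remaining indices ranging as in $\|\cdot\|_E$, $\|\cdot\|_H$. *)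

(* Defs.v *)
From mathcomp Require Import all_boot all_order all_algebra.

Set Implicit Arguments.
Unset Strict Implicit.
Unset Printing Implicit Defensive.

Import Order.TTheory GRing.Theory Num.Theory.
Local Open Scope ring_scope.

Inductive dir := dirX | dirY | dirZ.

Scheme Boolean Equality for dir.

(* Spatial indices are counted in half steps: the integer [a] stands for the
   index a/2, so [nd l] is the integer index l, [hf l] is the
   half-integer index l + 1/2, and a shift by 1/2 is a shift by 1. *)
Definition nd (l : nat) : int := (l.*2)%:Z.
Definition hf (l : nat) : int := (l.*2.+1)%:Z.

(* Grid functions are total on all triples of half-step indices; the values off
   a component's own staggered grid are unconstrained, and neither the scheme,
   nor the boundary condition, nor the norms ever read them. *)
Definition gfun (R : Type) := int -> int -> int -> R.
Definition vfun (R : Type) := dir -> gfun R.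

Definition nodes (n : nat) : seq int := [seq nd l | l <- index_iota 0 n.+1].
Definition halves (n : nat) : seq int := [seq hf l | l <- index_iota 0 n].
Definition inner_nodes (n : nat) : seq int := [seq nd l | l <- index_iota 1 n].
Definition inner_halves (n : nat) : seq int :=
  [seq hf l | l <- index_iota 1 n.-1].
Definition end_nodes (n : nat) : seq int := [:: nd 0; nd n].
(* A list, not a set: for n = 2 the node 1 occurs twice. *)
Definition near_nodes (n : nat) : seq int := [:: nd 1; nd n.-1].

Definition cells (I J K : nat) (d : dir) : nat :=
  match d with dirX => I | dirY => J | dirZ => K end.

(* An index range assigns to component [c] and direction [d] the list of
   indices run through in direction [d]. *)
Definition range := dir -> dir -> seq int.

Section Ranges.
Variable L : dir -> nat.

Definition E_points : range := fun c d =>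
  if dir_beq d c then halves (L d) else nodes (L d).
Definition H_points : range := fun c d =>
  if dir_beq d c then nodes (L d) else halves (L d).
(* The E-points that are not on a face where the component is tangential. *)
Definition E_inner : range := fun c d =>
  if dir_beq d c then halves (L d) else inner_nodes (L d).

Definition E_diff (w : dir) : range := fun c d =>
  if dir_beq d w then
    (if dir_beq d c then inner_nodes (L d) else inner_halves (L d))
  else E_inner c d.
Definition H_diff (w : dir) : range := fun c d =>
  if dir_beq d w then
    (if dir_beq d c then inner_halves (L d) else inner_nodes (L d))
  else H_points c d.

Definition E_near (w : dir) : range := fun c d =>
  if dir_beq d w then near_nodes (L d) else E_inner c d.
Definition H_near (w : dir) : range := fun c d =>
  if dir_beq d w then near_nodes (L d) else H_points c d.

End Ranges.

Definition at_point (r : range) (c : dir) (a b d : int) : bool :=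
  [&& a \in r c dirX, b \in r c dirY & d \in r c dirZ].

Section Grid.
Variables (R : realFieldType) (L : dir -> nat).
Implicit Types (U E H : vfun R) (r : range) (w c : dir).

Definition step w : R := 1 / (L w)%:R.

Definition cell_volume : R := step dirX * step dirY * step dirZ.

Definition delta w (f : gfun R) : gfun R := fun a b d =>
  match w with
  | dirX => (f (a + 1) b d - f (a - 1) b d) / step dirX
  | dirY => (f a (b + 1) d - f a (b - 1) d) / step dirY
  | dirZ => (f a b (d + 1) - f a b (d - 1)) / step dirZ
  end.

Definition vdelta w U : vfun R := fun c => delta w (U c).

Definition delta1h U : vfun R := fun c =>
  match c with
  | dirX => delta dirY (U dirZ)
  | dirY => delta dirZ (U dirX)
  | dirZ => delta dirX (U dirY)
  end.

Definition delta2h U : vfun R := fun c =>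
  match c with
  | dirX => delta dirZ (U dirY)
  | dirY => delta dirX (U dirZ)
  | dirZ => delta dirY (U dirX)
  end.

Definition PEC U : Prop :=
  [/\ forall a b d, at_point (E_points L) dirX a b d ->
        (b \in end_nodes (L dirY)) || (d \in end_nodes (L dirZ)) ->
        U dirX a b d = 0,
      forall a b d, at_point (E_points L) dirY a b d ->
        (a \in end_nodes (L dirX)) || (d \in end_nodes (L dirZ)) ->
        U dirY a b d = 0
    & forall a b d, at_point (E_points L) dirZ a b d ->
        (a \in end_nodes (L dirX)) || (b \in end_nodes (L dirY)) ->
        U dirZ a b d = 0].

(* [update r dt k U U' V W] is (U' - U) / dt = k (V - W), componentwise on the
   points of [r].  The right-hand sides of the six equations of each stage are
   exactly the components of delta1h minus delta2h (E-equations) and of delta2h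
   minus delta1h (H-equations), taken at the time levels shown below. *)
Definition update r (dt k : R) (U U' V W : vfun R) : Prop :=
  forall c a b d, at_point r c a b d ->
    (U' c a b d - U c a b d) / dt = k * (V c a b d - W c a b d).

Definition ADI_stage1 (eps mu dt : R) (E0 H0 E1 H1 : vfun R) : Prop :=
  update (E_inner L) dt (1 / (2 * eps)) E0 E1 (delta1h H1) (delta2h H0) /\
  update (H_points L) dt (1 / (2 * mu)) H0 H1 (delta2h E1) (delta1h E0).

Definition ADI_stage2 (eps mu dt : R) (E1 H1 E2 H2 : vfun R) : Prop :=
  update (E_inner L) dt (1 / (2 * eps)) E1 E2 (delta1h H1) (delta2h H2) /\
  update (H_points L) dt (1 / (2 * mu)) H1 H2 (delta2h E1) (delta1h E2).

(* Time levels are counted in half steps as well: [E n.*2] is E^n and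
   [E n.*2.+1] is E^(n + 1/2). *)
Definition ADI_FDTD_solution (eps mu dt : R) (N : nat) (E H : nat -> vfun R) :
    Prop :=
  (forall n, (n < N)%N ->
     ADI_stage1 eps mu dt (E n.*2) (H n.*2) (E n.*2.+1) (H n.*2.+1) /\
     ADI_stage2 eps mu dt (E n.*2.+1) (H n.*2.+1) (E n.+1.*2) (H n.+1.*2)) /\
  (forall m, (m <= N.*2)%N -> PEC (E m)).

Definition sum_sq r c (f : gfun R) : R :=
  \sum_(a <- r c dirX) \sum_(b <- r c dirY) \sum_(d <- r c dirZ) (f a b d) ^+ 2.

Definition vsum_sq r U : R :=
  sum_sq r dirX (U dirX) + sum_sq r dirY (U dirY) + sum_sq r dirZ (U dirZ).

(* Squared norms.  The weight [P] is an argument: it is eps for grid functions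
   obtained from E and mu for those obtained from H, irrespective of the points
   they live on.  [dnormE2 P w U] is the square of the norm of delta_w U. *)
Definition dnormE2 (P : R) w U : R :=
  cell_volume * P * vsum_sq (E_diff L w) (vdelta w U).
Definition dnormH2 (P : R) w U : R :=
  cell_volume * P * vsum_sq (H_diff L w) (vdelta w U).

Definition near_factor w : R :=
  match w with
  | dirX => step dirY * step dirZ / step dirX
  | dirY => step dirX * step dirZ / step dirY
  | dirZ => step dirX * step dirY / step dirZ
  end.

(* The norms with subscript I, J, K (for w = x, y, z): on E-points they use the
   two components tangential to the faces w = const, on H-points the normal
   one. *)
Definition near_normE2 (P : R) w U : R :=
  near_factor w * P *
  match w with
  | dirX => sum_sq (E_near L w) dirY (U dirY) + sum_sq (E_near L w) dirZ (U dirZ)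
  | dirY => sum_sq (E_near L w) dirX (U dirX) + sum_sq (E_near L w) dirZ (U dirZ)
  | dirZ => sum_sq (E_near L w) dirX (U dirX) + sum_sq (E_near L w) dirY (U dirY)
  end.
Definition near_normH2 (P : R) w U : R :=
  near_factor w * P * sum_sq (H_near L w) w (U w).

Definition energy (eps mu dt : R) w E H : R :=
  dnormE2 eps w E + dnormH2 mu w H
  + dt ^+ 2 / (4 * mu * eps) *
      (dnormH2 eps w (delta1h E) + dnormE2 mu w (delta2h H))
  + near_normE2 eps w E + near_normH2 mu w H
  + dt ^+ 2 / (4 * mu * eps) *
      (near_normE2 mu w (delta2h H) + near_normH2 eps w (delta1h E)).

End Grid.

(* Main.v *)
Require Import Defs.
From mathcomp Require Import all_boot all_order all_algebra.
From mathcomp Require Import zify ring lra.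

(** Each stage of the scheme equates an expression in the new fields with one
    in the old fields: with h = dt / 2, A = delta1h and B = delta2h,
<<
      E1 - (h/eps) A H1 = E0 - (h/eps) B H0,
      H1 - (h/mu)  B E1 = H0 - (h/mu)  A E0,
      E2 + (h/eps) B H2 = E1 + (h/eps) A H1,
      H2 + (h/mu)  A E2 = H1 + (h/mu)  B E1.
>>
    Take squared norms, weight the E-equations by eps and the H-equations by
    mu, and add.  All cross terms come with the same factor 2h, as in
    <E1, A H1> + <H1, B E1>, and they cancel whenever A and B are, up to sign,
    adjoint to each other.  What is left says that
    eps |E|^2 + mu |H|^2 + h^2 (|B H|^2 / eps + |A E|^2 / mu)
    is the same before and after the two stages; in the middle it appears with
    A and B exchanged ([ADI_energy_balance], [ADI_step]).

    It remains to see which inner product turns the left-hand side of the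
    theorem into such an energy.  Along the direction w a component is indexed
    either by nodes or by half nodes.  Replace the values of a node-indexed
    component on the two end nodes by zero, and take <U, V> to be the sum of the
    products of the w-differences of U and V.  The differences that touch an
    end node are then the values on the nodes 1 and L - 1 divided by the step,
    so the norm of delta_w together with the near-boundary norm is exactly the
    squared norm for this inner product ([E_normE], [H_normE]).  The
    end-node values removed in this way are zero for E and delta1h E by the
    boundary condition; those of the normal component of H and of the tangential
    components of delta2h H are read neither by these norms nor by the
    E-equations.

    For this inner product A and B are still adjoint up to sign
    ([delta12_adjoint], [delta21_adjoint]).  A term of A or B differentiates in
    one direction d.  If d differs from w, the two differences commute and this
    is summation by parts in d.  If d = w, the differences of a node-indexed
    component live on half nodes, those of a half-indexed one live on the inner
    nodes and may be extended by zero, so the same summation by parts applies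
    with the two roles exchanged ([delta_adjoint]). *)

Set Implicit Arguments.
Unset Strict Implicit.
Unset Printing Implicit Defensive.

Import Order.TTheory GRing.Theory Num.Theory.
Local Open Scope ring_scope.

(** * Index ranges in one direction *)

Lemma ndD1 l : nd l + 1 = hf l. Proof. rewrite /nd /hf; lia. Qed.
Lemma hfD1 l : hf l + 1 = nd l.+1. Proof. rewrite /nd /hf; lia. Qed.
Lemma hfB1 l : hf l - 1 = nd l. Proof. rewrite /nd /hf; lia. Qed.
Lemma ndSB1 l : nd l.+1 - 1 = hf l. Proof. rewrite /nd /hf; lia. Qed.

Lemma nodesP n t : reflect (exists2 l, (l <= n)%N & t = nd l) (t \in nodes n).
Proof.
apply: (iffP mapP) => -[l l_n ->]; exists l => //.
  by move: l_n; rewrite mem_index_iota.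
by rewrite mem_index_iota.
Qed.

Lemma halvesP n t : reflect (exists2 l, (l < n)%N & t = hf l) (t \in halves n).
Proof.
apply: (iffP mapP) => -[l l_n ->]; exists l => //.
  by move: l_n; rewrite mem_index_iota.
by rewrite mem_index_iota.
Qed.

Lemma inner_nodesP n t :
  reflect (exists2 l, (l.+1 < n)%N & t = nd l.+1) (t \in inner_nodes n).
Proof.
apply: (iffP mapP) => -[l l_n ->].
  by case: l l_n => [|l]; rewrite mem_index_iota // => l_n; exists l.
by exists l.+1; rewrite ?mem_index_iota.
Qed.

Lemma end_nodesE n t : (t \in end_nodes n) = (t == nd 0) || (t == nd n).
Proof. by rewrite !inE. Qed.

Definition neighbours_in (r s : seq int) :=
  forall t, t \in r -> t + 1 \in s /\ t - 1 \in s.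

Lemma halves_neighbours n : neighbours_in (halves n) (nodes n).
Proof.
move=> _ /halvesP[l l_n ->]; rewrite hfD1 hfB1.
by split; apply/nodesP; [exists l.+1 | exists l => //; apply: ltnW].
Qed.

Lemma inner_nodes_neighbours n : neighbours_in (inner_nodes n) (halves n).
Proof.
move=> _ /inner_nodesP[l l_n ->]; rewrite ndD1 ndSB1.
by split; apply/halvesP; [exists l.+1 | exists l => //; apply: ltnW].
Qed.

Lemma nodes_inner n t :
  t \in nodes n -> t \in end_nodes n = false -> t \in inner_nodes n.
Proof.
move=> /nodesP[l l_n ->]; rewrite end_nodesE => /norP[l_n0 l_nn].
apply/inner_nodesP; case: l l_n l_n0 l_nn => [|l] l_n; rewrite ?eqxx // => _.
by exists l => //; rewrite ltn_neqAle l_n andbT; apply: contraNneq l_nn => ->.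
Qed.

Lemma inner_nodes_sub n : {subset inner_nodes n <= nodes n}.
Proof.
move=> _ /inner_nodesP[l l_n ->].
by apply/nodesP; exists l.+1 => //; apply: ltnW.
Qed.

Lemma inner_nodes_end n t : t \in inner_nodes n -> t \in end_nodes n = false.
Proof. case/inner_nodesP=> l l_n ->; rewrite end_nodesE /nd; lia. Qed.

Lemma halves_end n t : t \in halves n -> t \in end_nodes n = false.
Proof. case/halvesP=> l l_n ->; rewrite end_nodesE /nd /hf; lia. Qed.

Lemma sum_nodes (R : realFieldType) n (u : int -> R) :
  (0 < n)%N -> (forall t, t \in end_nodes n -> u t = 0) ->
  \sum_(t <- nodes n) u t = \sum_(t <- inner_nodes n) u t.
Proof.
case: n => // n _ u0; rewrite !big_map big_nat_recl // big_nat_recr //=.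
rewrite !u0 ?inE ?eqxx ?orbT // add0r addr0 (big_addn 0 n.+1 1) subn1.
by apply: eq_bigr => i _; rewrite addn1.
Qed.

(** The boundary terms of the summation by parts are
    u (nd n) * v (hf n.-1) - u (nd 0) * v (hf 0), which is why only the factor
    on the nodes has to vanish at the ends. *)
Lemma sum_by_parts (R : realFieldType) n (u v : int -> R) :
  (0 < n)%N -> (forall t, t \in end_nodes n -> u t = 0) ->
  \sum_(t <- inner_nodes n) u t * (v (t + 1) - v (t - 1)) +
  \sum_(t <- halves n) (u (t + 1) - u (t - 1)) * v t = 0.
Proof.
case: n => // n _ u0.
suff tele : \sum_(t <- inner_nodes n.+1) u t * (v (t + 1) - v (t - 1)) +
    \sum_(t <- halves n.+1) (u (t + 1) - u (t - 1)) * v t =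
    u (nd n.+1) * v (hf n) - u (nd 0) * v (hf 0).
  by rewrite tele !u0 ?inE ?eqxx ?orbT // !mul0r subrr.
rewrite !big_map (big_addn 0 n.+1 1) subn1 /=.
elim: n {u0} => [|n IHn].
  by rewrite big_geq // big_nat1 hfD1 hfB1 add0r mulrBl.
rewrite big_nat_recr //= [X in _ + X]big_nat_recr //= addrACA IHn.
rewrite addn1 ndD1 ndSB1 hfD1 hfB1; ring.
Qed.

(** Here [u] is [v] with its end values replaced by zero.  The first and the
    last difference of [u] reduce to the values of [v] on the nodes next to the
    ends: this is where the near-boundary norms come from. *)
Lemma sum_halves_sq (R : realFieldType) n (u v : int -> R) :
  (1 < n)%N -> (forall t, t \in end_nodes n -> u t = 0) ->
  (forall t, t \in inner_nodes n -> u t = v t) ->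
  \sum_(t <- halves n) (u (t + 1) - u (t - 1)) ^+ 2 =
  \sum_(t <- inner_halves n) (v (t + 1) - v (t - 1)) ^+ 2 +
  \sum_(t <- near_nodes n) v t ^+ 2.
Proof.
case: n => [|[|n]] // _ u0 uv.
have uvS i : (i < n.+1)%N -> u (nd i.+1) = v (nd i.+1).
  by move=> i_n; apply/uv/inner_nodesP; exists i.
rewrite !big_map big_nat_recl // big_nat_recr //= !big_cons big_nil.
rewrite (big_addn 0 n.+1 1) subn1 /= !(hfD1, hfB1).
rewrite (u0 (nd 0)) ?(u0 (nd n.+2)) ?inE ?eqxx ?orbT // !uvS //.
rewrite (eq_big_nat _ _ (F2 := fun i =>
  (v (hf (i + 1) + 1) - v (hf (i + 1) - 1)) ^+ 2)) => [|i /andP[_ i_n]].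
  ring.
by rewrite addn1 hfD1 hfB1 !uvS // ltnW.
Qed.

(** * Sums over boxes *)

Definition in_box (r : dir -> seq int) (x y z : int) : bool :=
  [&& x \in r dirX, y \in r dirY & z \in r dirZ].

Definition coord (w : dir) (x y z : int) : int :=
  match w with dirX => x | dirY => y | dirZ => z end.

Lemma dir_beqP (d e : dir) : reflect (d = e) (dir_beq d e).
Proof. by case: d; case: e; constructor. Qed.

Section Boxes.
Variable R : realFieldType.
Implicit Types (r s : dir -> seq int) (f g h : gfun R) (w d e : dir).

Definition box_sum r f : R :=
  \sum_(x <- r dirX) \sum_(y <- r dirY) \sum_(z <- r dirZ) f x y z.

Lemma eq_box_sum r f g :
  (forall x y z, in_box r x y z -> f x y z = g x y z) ->
  box_sum r f = box_sum r g.
Proof.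
move=> fg; apply: eq_big_seq => x rx; apply: eq_big_seq => y ry.
by apply: eq_big_seq => z rz; apply: fg; apply/and3P.
Qed.

Lemma eq_box r s f : (forall d, r d = s d) -> box_sum r f = box_sum s f.
Proof. by move=> rs; rewrite /box_sum !rs. Qed.

Lemma box_sumD r f g :
  box_sum r f + box_sum r g = box_sum r (fun x y z => f x y z + g x y z).
Proof.
rewrite /box_sum -big_split; apply: eq_bigr => x _.
by rewrite -big_split; apply: eq_bigr => y _; rewrite -big_split.
Qed.

Lemma box_sumZ r k f : k * box_sum r f = box_sum r (fun x y z => k * f x y z).
Proof.
rewrite /box_sum mulr_sumr; apply: eq_bigr => x _.
by rewrite mulr_sumr; apply: eq_bigr => y _; rewrite mulr_sumr.
Qed.

(** The three directions are handled alike by bringing the chosen direction [w]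
    innermost; [side1] and [side2] are the two remaining ones and [line]
    restricts a grid function to a line parallel to [w]. *)
Definition side1 w := if w is dirX then dirY else dirX.
Definition side2 w := if w is dirZ then dirY else dirZ.

Definition line w f (p q t : int) : R :=
  match w with dirX => f t p q | dirY => f p t q | dirZ => f p q t end.

Lemma box_sum_lines w r f :
  box_sum r f = \sum_(p <- r (side1 w)) \sum_(q <- r (side2 w))
                  \sum_(t <- r w) line w f p q t.
Proof.
case: w; rewrite /box_sum //=.
  by rewrite exchange_big; apply: eq_bigr => p _; rewrite exchange_big.
by apply: eq_bigr => x _; rewrite exchange_big.
Qed.

Lemma sideP w : side1 w <> w /\ side2 w <> w.
Proof. by case: w. Qed.

Lemma eq_box_sum_lines w r s f g :
  (forall d, d <> w -> r d = s d) ->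
  (forall p q,
     \sum_(t <- r w) line w f p q t = \sum_(t <- s w) line w g p q t) ->
  box_sum r f = box_sum s g.
Proof.
have [w1 w2] := sideP w; move=> rs fg.
rewrite !(box_sum_lines w) (rs _ w1) (rs _ w2); apply: eq_bigr => p _.
by apply: eq_bigr => q _; apply: fg.
Qed.

End Boxes.

(** * Differences of fields with cleared end values *)

Section Fields.
Variables (R : realFieldType) (L : dir -> nat).
Hypothesis L_gt1 : forall w, (1 < L w)%N.
Implicit Types (r s : dir -> seq int) (f g : gfun R) (U V : vfun R).
Implicit Types (w c d e : dir).

Let L_gt0 w : (0 < L w)%N := ltnW (L_gt1 w).

Let step_neq0 w : step R L w != 0.
Proof. by rewrite /step div1r invr_eq0 pnatr_eq0 -lt0n. Qed.

Definition zero_at_ends w f :=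
  forall x y z, coord w x y z \in end_nodes (L w) -> f x y z = 0.

Definition clear w f : gfun R := fun x y z =>
  if coord w x y z \in end_nodes (L w) then 0 else f x y z.

Lemma clear_zero w f : zero_at_ends w (clear w f).
Proof. by move=> x y z ends; rewrite /clear ends. Qed.

Lemma zero_clear w d f : zero_at_ends d f -> zero_at_ends d (clear w f).
Proof. by move=> f0 x y z ends; rewrite /clear f0 // if_same. Qed.

Lemma clear_id w f x y z : zero_at_ends w f -> clear w f x y z = f x y z.
Proof. by rewrite /clear => f0; case: ifP => // /f0. Qed.

Lemma eq_delta w f g :
  (forall x y z, f x y z = g x y z) ->
  forall x y z, delta L w f x y z = delta L w g x y z.
Proof. by case: w => fg x y z /=; rewrite !fg. Qed.

Lemma line_delta w f p q t :
  line w (delta L w f) p q t =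
  (line w f p q (t + 1) - line w f p q (t - 1)) / step R L w.
Proof. by case: w. Qed.

Lemma lineM w f g p q t :
  line w (fun x y z => f x y z * g x y z) p q t =
  line w f p q t * line w g p q t.
Proof. by case: w. Qed.

Lemma line_sq w f p q t :
  line w (fun x y z => f x y z ^+ 2) p q t = line w f p q t ^+ 2.
Proof. by case: w. Qed.

Lemma line_zero w f p q t :
  zero_at_ends w f -> t \in end_nodes (L w) -> line w f p q t = 0.
Proof. by case: w => f0 ends; apply: f0. Qed.

Lemma zero_delta w d f :
  w <> d -> zero_at_ends d f -> zero_at_ends d (delta L w f).
Proof.
by case: w; case: d => // _ f0 x y z ends; rewrite /delta !f0 // subrr mul0r.
Qed.

Lemma delta_local w r s f g x y z :
  neighbours_in (r w) (s w) -> (forall e, e <> w -> {subset r e <= s e}) ->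
  (forall x y z, in_box s x y z -> f x y z = g x y z) ->
  in_box r x y z -> delta L w f x y z = delta L w g x y z.
Proof.
move=> nb sub fg /and3P[rx ry rz].
case: w nb sub => nb sub /=; rewrite !fg //; apply/and3P; split=> //.
all: by [apply: sub | case: (nb x) | case: (nb y) | case: (nb z)].
Qed.

(** The components of H are summed over all nodes in their normal direction,
    those of E only over inner nodes; products that vanish on the faces do not
    see the difference. *)
Lemma box_sum_nodes e r s f :
  r e = nodes (L e) -> s e = inner_nodes (L e) ->
  (forall d, d <> e -> r d = s d) -> zero_at_ends e f ->
  box_sum r f = box_sum s f.
Proof.
move=> re se rs f0; apply: (eq_box_sum_lines rs) => p q; rewrite re se.
by apply: sum_nodes => // t; apply: line_zero.
Qed.

Lemma box_sum_by_parts w r s f g :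
  r w = inner_nodes (L w) -> s w = halves (L w) ->
  (forall d, d <> w -> r d = s d) -> zero_at_ends w f ->
  box_sum r (fun x y z => f x y z * delta L w g x y z) +
  box_sum s (fun x y z => delta L w f x y z * g x y z) = 0.
Proof.
move=> rw sw rs f0; have [w1 w2] := sideP w.
rewrite !(box_sum_lines w) rw sw (rs _ w1) (rs _ w2).
rewrite -big_split big1 // => p _ /=; rewrite -big_split big1 // => q _ /=.
have sbp := @sum_by_parts _ (L w) (line w f p q) (line w g p q) (L_gt0 w).
rewrite -[RHS](mul0r (step R L w)^-1) -[X in _ = X * _]sbp; last first.
  by move=> t; apply: line_zero.
rewrite mulrDl !mulr_suml; congr (_ + _); apply: eq_bigr => t _.
  by rewrite lineM line_delta mulrA.
by rewrite lineM line_delta mulrAC.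
Qed.

(** On grid functions with half-integer index in direction [w] this is the plain
    difference, since a half node is never an end node; so one definition serves
    both kinds of components. *)
Definition cdelta w f : gfun R := delta L w (clear w f).

Lemma cdelta_delta w d f x y z :
  w <> d -> cdelta w (delta L d f) x y z = delta L d (cdelta w f) x y z.
Proof.
rewrite /cdelta /clear; case: w; case: d => //= _.
all: by do 2?case: ifP => _; ring.
Qed.

(** The points of [cdelta w] of an E-field.  In direction [w] nodes and half
    nodes are exchanged, and, unlike in [E_diff], no half node is left out,
    since [cdelta] also makes sense next to the faces. *)
Definition E_dgrid w c d : seq int :=
  if dir_beq d w then (if dir_beq d c then inner_nodes (L d) else halves (L d))
  else E_inner L c d.

Definition H_dgrid w c d : seq int :=
  if dir_beq d w then (if dir_beq d c then halves (L d) else inner_nodes (L d))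
  else H_points L c d.

Lemma zero_cdelta w d f :
  w <> d -> zero_at_ends d f -> zero_at_ends d (cdelta w f).
Proof. by move=> wd f0; apply/zero_delta/zero_clear. Qed.

Lemma in_box_coord w r x y z : in_box r x y z -> coord w x y z \in r w.
Proof. by case: w => /and3P[]. Qed.

Lemma cdelta_inner_nodes w r f x y z :
  r w = inner_nodes (L w) -> in_box r x y z ->
  cdelta w f x y z = delta L w f x y z.
Proof.
rewrite /cdelta /clear => rw /(in_box_coord w); rewrite rw.
case/inner_nodes_neighbours => t1 t2.
by case: w rw t1 t2 => /= rw t1 t2; rewrite !halves_end.
Qed.

(** * The two halves of the discrete curl are adjoint up to sign *)

Definition tangential_zero U :=
  forall c d, d <> c -> zero_at_ends d (U c).

Definition distinct c d e :=
  [&& ~~ dir_beq c d, ~~ dir_beq c e & ~~ dir_beq d e].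

(** One pair of terms of the discrete curl: the component [c] of E and the
    component [e] of H, coupled by the difference in the third direction [d].
    Along [c] both are indexed by half nodes and along [e] both by nodes, so
    only the direction [d] is affected by the summation by parts. *)
Lemma delta_adjoint w c d e U V : distinct c d e -> tangential_zero U ->
  box_sum (E_dgrid w c)
    (fun x y z => cdelta w (U c) x y z * cdelta w (delta L d (V e)) x y z) +
  box_sum (H_dgrid w e)
    (fun x y z => cdelta w (V e) x y z * cdelta w (delta L d (U c)) x y z) = 0.
Proof.
case/and3P=> /dir_beqP cd /dir_beqP ce /dir_beqP de U0.
have u0d : zero_at_ends d (U c) by apply: U0 => dc; apply: cd.
have u0e : zero_at_ends e (U c) by apply: U0 => ec; apply: ce.
move: (U c) (V e) u0d u0e => {U0} u v u0d u0e.
(* The box of H with its nodes in direction e restricted to those of E: the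
   discarded points lie on faces where component c of E is tangential. *)
pose s a := if dir_beq a e then E_dgrid w c e else H_dgrid w e a.
have -> : box_sum (H_dgrid w e)
    (fun x y z => cdelta w v x y z * cdelta w (delta L d u) x y z) =
  box_sum s (fun x y z => cdelta w v x y z * cdelta w (delta L d u) x y z).
  case: (dir_beqP w e) => [we|we].
    apply: eq_box => a; rewrite /s; case: dir_beqP => // ->.
    by rewrite /E_dgrid /H_dgrid we; case: (c) ce; case: (e).
  apply: (@box_sum_nodes e).
  - by rewrite /H_dgrid /H_points; case: (w) we; case: (e).
  - by rewrite /s /E_dgrid /E_inner; case: (w) we; case: (e) ce; case: (c).
  - by move=> a; rewrite /s; case: (a); case: (e).
  - by move=> x y z ends; rewrite (zero_cdelta we (zero_delta de u0e)) ?mulr0.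
case: (dir_beqP w d) => [wd|wd].
  subst d.
  (* Differencing in direction w has exchanged the two kinds of indices: now the
     difference of v lives on the inner nodes, and it is extended by zero. *)
  have sw : s w = inner_nodes (L w).
    by rewrite /s /H_dgrid; case: (w) de; case: (e).
  rewrite addrC -[RHS](@box_sum_by_parts w s (E_dgrid w c)
    (clear w (delta L w v)) (cdelta w u)) //.
  - congr (_ + _); apply: eq_box_sum => x y z xyz; last exact: mulrC.
    rewrite !(@cdelta_inner_nodes w s _ x y z) //; congr (_ * _).
      rewrite /clear; move: (in_box_coord w xyz).
      by rewrite sw => /inner_nodes_end ->.
    by apply: eq_delta => a b f; apply: eq_delta => *; rewrite clear_id.
  - by rewrite /E_dgrid; case: (w) cd; case: (c).
  - move=> a; rewrite /s /E_dgrid /H_dgrid /E_inner /H_points.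
    by case: (a); case: (w) cd de; case: (c) ce; case: (e).
  - exact: clear_zero.
rewrite -[RHS](@box_sum_by_parts d (E_dgrid w c) s (cdelta w u) (cdelta w v)).
- congr (_ + _); apply: eq_box_sum => x y z _; rewrite cdelta_delta //.
  exact: mulrC.
- by rewrite /E_dgrid /E_inner; case: (w) wd; case: (d) cd; case: (c).
- by rewrite /s /H_dgrid /H_points; case: (w) wd; case: (d) de; case: (e).
- move=> a; rewrite /s /E_dgrid /H_dgrid /E_inner /H_points.
  by case: (a); case: (w) wd; case: (d) cd de; case: (c) ce; case: (e).
- exact: zero_cdelta.
Qed.

Definition form (r : range) w U V : R :=
  let term c :=
    box_sum (r c) (fun x y z => cdelta w (U c) x y z * cdelta w (V c) x y z) in
  term dirX + term dirY + term dirZ.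

Definition E_form w := form (E_dgrid w) w.
Definition H_form w := form (H_dgrid w) w.

Lemma cdeltaDZ w k f g x y z :
  cdelta w (fun x y z => f x y z + k * g x y z) x y z =
  cdelta w f x y z + k * cdelta w g x y z.
Proof. by rewrite /cdelta /clear; case: w => /=; do 2?case: ifP => _; ring. Qed.

Lemma form_sqD (r : range) w k U V :
  let W : vfun R := fun c x y z => U c x y z + k * V c x y z in
  form r w W W = form r w U U + 2 * k * form r w U V + k ^+ 2 * form r w V V.
Proof.
have sq c : box_sum (r c) (fun x y z =>
      cdelta w (fun x y z => U c x y z + k * V c x y z) x y z *
      cdelta w (fun x y z => U c x y z + k * V c x y z) x y z) =
    box_sum (r c) (fun x y z => cdelta w (U c) x y z * cdelta w (U c) x y z) +
    2 * k *
    box_sum (r c) (fun x y z => cdelta w (U c) x y z * cdelta w (V c) x y z) +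
    k ^+ 2 *
    box_sum (r c) (fun x y z => cdelta w (V c) x y z * cdelta w (V c) x y z).
  rewrite !box_sumZ !box_sumD; apply: eq_box_sum => x y z _.
  by rewrite !cdeltaDZ; ring.
by rewrite /form /= !sq; ring.
Qed.

Lemma eq_form (r : range) w U V :
  (forall c x y z, in_box (r c) x y z ->
     cdelta w (U c) x y z = cdelta w (V c) x y z) ->
  form r w U U = form r w V V.
Proof.
by move=> UV; rewrite /form; congr (_ + _ + _); apply: eq_box_sum => x y z xyz;
  rewrite UV.
Qed.

Lemma eq_E_form w U V :
  (forall c x y z, at_point (E_inner L) c x y z -> U c x y z = V c x y z) ->
  E_form w U U = E_form w V V.
Proof.
move=> UV; apply: eq_form => c x y z.
(* All points read by the w-differences before clearing; its end nodes are
   exactly the points of s that are not in E_inner. *)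
pose s d := if dir_beq d w then
  (if dir_beq d c then halves (L d) else nodes (L d)) else E_inner L c d.
apply: (@delta_local w _ s).
- rewrite /E_dgrid /s; case: (w); case: (c) => /=;
  by [apply: halves_neighbours | apply: inner_nodes_neighbours].
- by move=> e ew; rewrite /E_dgrid /s; case: (dir_beqP e w) => [/ew|_ t] //.
- move=> {}x {}y {}z sxyz; rewrite /clear; case: ifP => // ends.
  apply: UV; move: sxyz ends; rewrite /at_point /in_box /s /E_inner.
  by case: (w); case: (c) => //= /and3P[? ? ?] ends; apply/and3P;
    split => //; apply: nodes_inner.
Qed.

Lemma eq_H_form w U V :
  (forall c x y z, at_point (H_points L) c x y z -> U c x y z = V c x y z) ->
  H_form w U U = H_form w V V.
Proof.
move=> UV; apply: eq_form => c x y z; apply: (@delta_local w _ (H_points L c)).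
- rewrite /H_dgrid /H_points; case: (w); case: (c) => /=;
  by [apply: halves_neighbours | apply: inner_nodes_neighbours].
- by move=> e ew; rewrite /H_dgrid; case: (dir_beqP e w) => [/ew|_ t] //.
- by move=> {}x {}y {}z xyz; rewrite /clear; case: ifP => // _; apply: UV.
Qed.

(** The pairs are (E_x, H_z), (E_y, H_x), (E_z, H_y), coupled by the differences
    in y, z, x respectively. *)
Lemma delta12_adjoint w U V : tangential_zero U ->
  E_form w U (delta1h L V) + H_form w V (delta2h L U) = 0.
Proof.
move=> U0; have cross c d e de := @delta_adjoint w c d e U V de U0.
rewrite /E_form /H_form /form /=.
have := cross dirX dirY dirZ isT; have := cross dirY dirZ dirX isT.
by have := cross dirZ dirX dirY isT; lra.
Qed.

(** The pairs are (E_x, H_y), (E_y, H_z), (E_z, H_x), coupled by the differences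
    in z, x, y respectively. *)
Lemma delta21_adjoint w U V : tangential_zero U ->
  E_form w U (delta2h L V) + H_form w V (delta1h L U) = 0.
Proof.
move=> U0; have cross c d e de := @delta_adjoint w c d e U V de U0.
rewrite /E_form /H_form /form /=.
have := cross dirX dirZ dirY isT; have := cross dirY dirX dirZ isT.
by have := cross dirZ dirY dirX isT; lra.
Qed.

(** * Conservation of energy *)

(** Squaring the two equations and weighting them by [eps] and [mu] gives the
    mixed terms the common factor 2h, so that the last two hypotheses remove
    them.  For the first stage [h] is - dt / 2, for the second one dt / 2. *)
Lemma ADI_energy_balance w (eps mu h : R) (E E' X X' H H' Y Y' : vfun R) :
  eps != 0 -> mu != 0 ->
  (forall c x y z, at_point (E_inner L) c x y z ->
     E' c x y z + h / eps * X' c x y z = E c x y z + h / eps * X c x y z) ->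
  (forall c x y z, at_point (H_points L) c x y z ->
     H' c x y z + h / mu * Y' c x y z = H c x y z + h / mu * Y c x y z) ->
  E_form w E X + H_form w H Y = 0 -> E_form w E' X' + H_form w H' Y' = 0 ->
  eps * E_form w E' E' + mu * H_form w H' H' +
    h ^+ 2 * (E_form w X' X' / eps + H_form w Y' Y' / mu) =
  eps * E_form w E E + mu * H_form w H H +
    h ^+ 2 * (E_form w X X / eps + H_form w Y Y / mu).
Proof.
move=> eps0 mu0 /(@eq_E_form w) eqE /(@eq_H_form w) eqH cross cross'.
have weighted (m a b k : R) : m != 0 ->
    m * (a + 2 * (h / m) * b + (h / m) ^+ 2 * k) =
    m * a + 2 * (h * b) + h ^+ 2 * (k / m).
  by move=> m0; field.
move: eqE eqH; rewrite /E_form /H_form !form_sqD => eqE eqH.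
have := congr2 (fun a b => eps * a + mu * b) eqE eqH.
have := congr1 ( *%R h) cross; have := congr1 ( *%R h) cross'.
rewrite !weighted // /E_form /H_form !mulrDr mulr0; lra.
Qed.

Lemma box_sum_halves_sq w r r1 r2 f :
  r w = halves (L w) -> r1 w = inner_halves (L w) -> r2 w = near_nodes (L w) ->
  (forall d, d <> w -> r1 d = r d) -> (forall d, d <> w -> r2 d = r d) ->
  box_sum r (fun x y z => cdelta w f x y z * cdelta w f x y z) =
  box_sum r1 (fun x y z => delta L w f x y z ^+ 2) +
  (step R L w)^-2 * box_sum r2 (fun x y z => f x y z ^+ 2).
Proof.
move=> rw r1w r2w r1r r2r; have [w1 w2] := sideP w.
rewrite !(box_sum_lines w) rw r1w r2w !r1r // !r2r //.
rewrite mulr_sumr -big_split; apply: eq_bigr => p _ /=.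
rewrite mulr_sumr -big_split; apply: eq_bigr => q _ /=.
transitivity ((step R L w)^-2 * (\sum_(t <- halves (L w))
   (line w (clear w f) p q (t + 1) - line w (clear w f) p q (t - 1)) ^+ 2)).
  rewrite mulr_sumr; apply: eq_bigr => t _.
  by rewrite lineM line_delta -expr2 exprMn exprVn mulrC.
rewrite (sum_halves_sq (v := line w f p q)) ?mulrDr //; last 2 first.
- by move=> t; apply/line_zero/clear_zero.
- by move=> t /inner_nodes_end; rewrite /clear; case: (w) => /= ->.
congr (_ + _); last by congr (_ * _); apply: eq_bigr => t _; rewrite line_sq.
rewrite mulr_sumr; apply: eq_bigr => t _.
by rewrite line_sq line_delta [RHS]exprMn exprVn mulrC.
Qed.

Lemma box_sum_inner_nodes_sq w r f :
  r w = inner_nodes (L w) ->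
  box_sum r (fun x y z => cdelta w f x y z * cdelta w f x y z) =
  box_sum r (fun x y z => delta L w f x y z ^+ 2).
Proof.
move=> rw; apply: eq_box_sum => x y z xyz.
by rewrite (cdelta_inner_nodes f rw xyz) expr2.
Qed.

Lemma near_factorE w : near_factor R L w = cell_volume R L * (step R L w)^-2.
Proof.
have x0 := step_neq0 dirX; have y0 := step_neq0 dirY; have z0 := step_neq0 dirZ.
by rewrite /near_factor /cell_volume; case: w; field.
Qed.

(** The two components tangential to the faces w = const are indexed by nodes in
    direction [w] and account for the near-boundary norm. *)
Lemma E_normE P w U :
  dnormE2 L P w U + near_normE2 L P w U = cell_volume R L * P * E_form w U U.
Proof.
have tangential c : c <> w -> box_sum (E_dgrid w c)
      (fun x y z => cdelta w (U c) x y z * cdelta w (U c) x y z) =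
    sum_sq (E_diff L w) c (vdelta L w U c) +
    (step R L w)^-2 * sum_sq (E_near L w) c (U c).
  move=> cw; apply: box_sum_halves_sq.
  - by rewrite /E_dgrid; case: (w) cw; case: (c).
  - by rewrite /E_diff; case: (w) cw; case: (c).
  - by rewrite /E_near; case: (w).
  - by move=> d dw; rewrite /E_diff /E_dgrid; case: (dir_beqP d w).
  - by move=> d dw; rewrite /E_near /E_dgrid; case: (dir_beqP d w).
have normal : box_sum (E_dgrid w w)
      (fun x y z => cdelta w (U w) x y z * cdelta w (U w) x y z) =
    sum_sq (E_diff L w) w (vdelta L w U w).
  rewrite box_sum_inner_nodes_sq; last by rewrite /E_dgrid; case: (w).
  by apply: eq_box => d; rewrite /E_dgrid /E_diff; case: (d); case: (w).
rewrite /dnormE2 /near_normE2 near_factorE /E_form /form /vsum_sq.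
by case: w tangential normal => tangential -> /=;
  rewrite !tangential //; ring.
Qed.

(** For H it is the component normal to the faces w = const that is indexed by
    nodes in direction [w]. *)
Lemma H_normE P w V :
  dnormH2 L P w V + near_normH2 L P w V = cell_volume R L * P * H_form w V V.
Proof.
have normal : box_sum (H_dgrid w w)
      (fun x y z => cdelta w (V w) x y z * cdelta w (V w) x y z) =
    sum_sq (H_diff L w) w (vdelta L w V w) +
    (step R L w)^-2 * sum_sq (H_near L w) w (V w).
  apply: box_sum_halves_sq.
  - by rewrite /H_dgrid; case: (w).
  - by rewrite /H_diff; case: (w).
  - by rewrite /H_near; case: (w).
  - by move=> d dw; rewrite /H_diff /H_dgrid; case: (dir_beqP d w).
  - by move=> d dw; rewrite /H_near /H_dgrid; case: (dir_beqP d w).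
have tangential c : c <> w -> box_sum (H_dgrid w c)
      (fun x y z => cdelta w (V c) x y z * cdelta w (V c) x y z) =
    sum_sq (H_diff L w) c (vdelta L w V c).
  move=> cw; rewrite box_sum_inner_nodes_sq.
    apply: eq_box => d; rewrite /H_dgrid /H_diff.
    by case: (d); case: (w) cw; case: (c).
  by rewrite /H_dgrid; case: (w) cw; case: (c).
rewrite /dnormH2 /near_normH2 near_factorE /H_form /form /vsum_sq.
by case: w normal tangential => -> tangential /=;
  rewrite !tangential //; ring.
Qed.

(** The adjointness lemmas need tangential components that vanish at every index
    triple on a face, while [PEC] only speaks of grid points.  Under
    [PEC] clearing the components there changes no value on the grid. *)
Definition pec_field U : vfun R := fun c =>
  match c with
  | dirX => clear dirY (clear dirZ (U dirX))
  | dirY => clear dirX (clear dirZ (U dirY))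
  | dirZ => clear dirX (clear dirY (U dirZ))
  end.

Lemma pec_field_zero U : tangential_zero (pec_field U).
Proof.
by case; case=> // _; first [exact: clear_zero | exact/zero_clear/clear_zero].
Qed.

Lemma pec_fieldE U : PEC L U -> forall c x y z,
  at_point (E_points L) c x y z -> U c x y z = pec_field U c x y z.
Proof.
case=> UX UY UZ [] x y z xyz; rewrite /pec_field /clear /coord.
all: by do 2?[case: ifP => [ends|_]] => //; rewrite (UX, UY, UZ) ?ends ?orbT.
Qed.

Lemma delta_pec c d e U : distinct c d e -> PEC L U ->
  forall x y z, at_point (H_points L) e x y z ->
  delta L d (U c) x y z = delta L d (pec_field U c) x y z.
Proof.
move=> cde /pec_fieldE pecE x y z.
apply: (@delta_local d _ (E_points L c)); last exact: pecE.
  by rewrite /H_points /E_points; case: (c) cde; case: (d); case: (e) => //= _;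
    apply: halves_neighbours.
by case=> // ad t; rewrite /H_points /E_points; case: (c) cde; case: (d) ad;
  case: (e).
Qed.

Lemma delta1h_pec U : PEC L U ->
  forall c x y z, at_point (H_points L) c x y z ->
  delta1h L U c x y z = delta1h L (pec_field U) c x y z.
Proof. by move=> pecU [] x y z; apply: delta_pec. Qed.

Lemma delta2h_pec U : PEC L U ->
  forall c x y z, at_point (H_points L) c x y z ->
  delta2h L U c x y z = delta2h L (pec_field U) c x y z.
Proof. by move=> pecU [] x y z; apply: delta_pec. Qed.

Lemma E_inner_points c x y z :
  at_point (E_inner L) c x y z -> at_point (E_points L) c x y z.
Proof.
by case: c => /and3P[? ? ?]; apply/and3P; split => //; apply: inner_nodes_sub.
Qed.

(** The weights of the mixed energy terms become 1 / eps and 1 / mu, because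
    delta2h H carries the weight mu on E-points and delta1h E the weight eps on
    H-points. *)
Lemma energyE eps mu dt w U V : eps != 0 -> mu != 0 -> PEC L U ->
  energy L eps mu dt w U V = cell_volume R L *
    (eps * E_form w (pec_field U) (pec_field U) + mu * H_form w V V +
     (dt / 2) ^+ 2 * (E_form w (delta2h L V) (delta2h L V) / eps +
       H_form w (delta1h L (pec_field U)) (delta1h L (pec_field U)) / mu)).
Proof.
move=> eps0 mu0 pecU.
have -> : energy L eps mu dt w U V =
    (dnormE2 L eps w U + near_normE2 L eps w U) +
    (dnormH2 L mu w V + near_normH2 L mu w V) +
    dt ^+ 2 / (4 * mu * eps) *
      ((dnormH2 L eps w (delta1h L U) + near_normH2 L eps w (delta1h L U)) +
       (dnormE2 L mu w (delta2h L V) + near_normE2 L mu w (delta2h L V))).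
  by rewrite /energy; ring.
rewrite !E_normE !H_normE.
rewrite -(@eq_E_form w U (pec_field U)); last first.
  by move=> c x y z /E_inner_points; apply: pec_fieldE.
rewrite -(@eq_H_form w (delta1h L U) (delta1h L (pec_field U))); last first.
  exact: delta1h_pec.
by field; rewrite eps0 mu0.
Qed.

Lemma update_sides (r : range) dt m U U' V W :
  dt != 0 -> m != 0 -> update r dt (1 / (2 * m)) U U' V W ->
  forall c x y z, at_point r c x y z ->
    U' c x y z - U c x y z = dt / 2 / m * (V c x y z - W c x y z).
Proof.
move=> dt0 m0 upd c x y z /upd/(congr1 ( *%R dt)).
by rewrite mulrC divfK // => ->; field.
Qed.

Lemma ADI_step w eps mu dt (E0 H0 E1 H1 E2 H2 : vfun R) :
  eps != 0 -> mu != 0 -> dt != 0 -> PEC L E0 -> PEC L E1 -> PEC L E2 ->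
  ADI_stage1 L eps mu dt E0 H0 E1 H1 -> ADI_stage2 L eps mu dt E1 H1 E2 H2 ->
  energy L eps mu dt w E2 H2 = energy L eps mu dt w E0 H0.
Proof.
move=> eps0 mu0 dt0 pec0 pec1 pec2.
case=> /update_sides eqE1 /update_sides eqH1.
case=> /update_sides eqE2 /update_sides eqH2.
rewrite !energyE //; congr (_ * _).
rewrite (@ADI_energy_balance w eps mu (dt / 2) (pec_field E1) _
  (delta1h L H1) _ H1 _ (delta2h L (pec_field E1))) //.
- rewrite -sqrrN (@ADI_energy_balance w eps mu (- (dt / 2)) (pec_field E0) _
    (delta2h L H0) _ H0 _ (delta1h L (pec_field E0))) //.
  + move=> c x y z xyz; have := eqE1 dt0 eps0 c x y z xyz.
    by rewrite -!(pec_fieldE _ (E_inner_points xyz)) //; lra.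
  + move=> c x y z xyz; have := eqH1 dt0 mu0 c x y z xyz.
    by rewrite -delta2h_pec // -delta1h_pec //; lra.
  + exact/delta21_adjoint/pec_field_zero.
  + exact/delta12_adjoint/pec_field_zero.
- move=> c x y z xyz; have := eqE2 dt0 eps0 c x y z xyz.
  by rewrite -!(pec_fieldE _ (E_inner_points xyz)) //; lra.
- move=> c x y z xyz; have := eqH2 dt0 mu0 c x y z xyz.
  by rewrite -delta2h_pec // -delta1h_pec //; lra.
- exact/delta12_adjoint/pec_field_zero.
- exact/delta21_adjoint/pec_field_zero.
Qed.

End Fields.

Theorem theorem3p2 (R : realFieldType) (eps mu T : R) (I J K N : nat)
    (E H : nat -> vfun R) :
  0 < eps -> 0 < mu -> 0 < T ->
  (2 <= I)%N -> (2 <= J)%N -> (2 <= K)%N -> (1 <= N)%N ->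
  ADI_FDTD_solution (cells I J K) eps mu (T / N%:R) N E H ->
  forall n : nat, (n <= N - 1)%N ->
  forall w : dir,
    energy (cells I J K) eps mu (T / N%:R) w (E n.+1.*2) (H n.+1.*2) =
    energy (cells I J K) eps mu (T / N%:R) w (E n.*2) (H n.*2).
Proof.
move=> eps0 mu0 T0 I2 J2 K2 N1 [scheme pec] n n_lt w.
have {}n_lt : (n < N)%N by lia.
have [stage1 stage2] := scheme n n_lt.
apply: ADI_step stage1 stage2; rewrite ?gt_eqF //; try by apply: pec; lia.
- by case.
- by rewrite divr_gt0 // ltr0n.
Qed.
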